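(* The map $\tau: C_{54}\to C_{54}$, $\tau=\varphi_{A_1}\circ \mathrm{dual}_{C_{54}}$, is an involution on $C_{54}$, i.e. $\tau\circ\tau=\mathrm{id}$.
   Context: $C_{54}\subset\mathbf P^2(\mathbf C)$ is the sextic with affine equation $(xy-x+y)^3+54x^2y^2=0$, i.e. the zero set of $F(X,Y,Z)=(XY-XZ+YZ)^3+54X^2Y^2Z^2$. Points are written as row vectors $(X,Y,Z)$. The Gauss map $\mathrm{dual}_{C_{54}}:C_{54}\to C_{54}^*$ to the dual curve is $(X,Y,Z)\mapsto(F_X,F_Y,F_Z)$ (partial derivatives evaluated at $(X,Y,Z)$), regarded as a rational map and extended to the three cusps $(1,0,0),(0,1,0),(0,0,1)$ by sending each to its unique tangent line. For $A\in\mathrm{GL}(3,\mathbf C)$, $\varphi_A$ is the automorphism of $\mathbf P^2$ given by right multiplication $(X,Y,Z)\mapsto(X,Y,Z)A$. Here $$A_1=\begin{pmatrix}-1/3&7/3&-1/3\\7/3&-1/3&1/3\\-1/3&1/3&-7/3\end{pmatrix},$$ and $\varphi_{A_1}$ maps $C_{54}^*$ onto $C_{54}$, so that $\tau$ is a self-map of $C_{54}$. *)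

(* Defs.v *)
From HB Require Import structures.
From mathcomp Require Import all_boot all_order all_algebra.
From mathcomp Require Import classical_sets reals.
From mathcomp Require Import complex mpoly.

Set Implicit Arguments.
Unset Strict Implicit.
Unset Printing Implicit Defensive.

Import GRing.Theory.

Local Open Scope ring_scope.
Local Open Scope quotient_scope.

(* R[i] is the field C of complex numbers. *)
Section ProjectivePlane.
Variable R : realType.

Definition nzvec := {v : 'rV[R[i]]_3 | v != 0}.

(* Equality of row spaces: for nonzero u and v this means u = c v, c != 0. *)
Definition proportional (u v : nzvec) : bool := (val u == val v)%MS.

Lemma proportional_refl : reflexive proportional.
Proof. by move=> u; apply/eqmxP. Qed.

Lemma proportional_sym : ssrbool.symmetric proportional.
Proof. by move=> u v; rewrite /proportional andbC. Qed.

Lemma proportional_trans : transitive proportional.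
Proof.
move=> v u w /eqmxP uv /eqmxP vw; apply/eqmxP.
exact: eqmx_trans uv vw.
Qed.

Canonical proportional_equiv :=
  EquivRel proportional proportional_refl proportional_sym proportional_trans.

(* The projective plane. A line aX + bY + cZ = 0 is encoded by the point     *)
(* (a, b, c), so that P2 also serves as the dual plane.                      *)
Definition P2 : Type := {eq_quot proportional_equiv}.

Lemma delta_neq0 (j : 'I_3) : delta_mx 0 j != 0 :> 'rV[R[i]]_3.
Proof.
by apply/eqP => /matrixP/(_ 0 j)/eqP; rewrite !mxE !eqxx oner_eq0.
Qed.

(* (1,0,0), (0,1,0) and (0,0,1) for j = 0, 1, 2. *)
Definition vertex (j : 'I_3) : P2 :=
  \pi_P2 (exist (fun v : 'rV[R[i]]_3 => v != 0) _ (delta_neq0 j)).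

(* The point with homogeneous coordinates v; the zero vector, which defines  *)
(* no point, is sent to an arbitrary one.                                    *)
Definition point_of (v : 'rV[R[i]]_3) : P2 :=
  if insub v is Some u then \pi_P2 u else vertex 0.

Definition coords (p : P2) : 'rV[R[i]]_3 := val (repr p).

(* phi_A; meant for invertible A. *)
Definition projective_map (A : 'M[R[i]]_3) (p : P2) : P2 :=
  point_of (coords p *m A).

End ProjectivePlane.

Section PlaneCurves.
Variable R : realType.
Implicit Types (F : {mpoly R[i][3]}) (v w : 'rV[R[i]]_3) (p l : P2 R).

Definition evalv F v : R[i] := F.@[fun j => v 0 j].

(* Meant for homogeneous F, for which the choice of coordinates of p does    *)
(* not matter.                                                               *)
Definition zero_locus F : {pred P2 R} := [pred p | evalv F (coords p) == 0].

Definition gradient F v : 'rV[R[i]]_3 := \row_j evalv F^`M(j) v.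

Definition incident p l : bool := coords p *m (coords l)^T == 0.

(* The polynomial F(v + t w) in t: F restricted to the line through the      *)
(* points v and w, t being a local parameter at v.                           *)
Definition restrict_line F v w : {poly R[i]} :=
  mmap (@polyC R[i]) (fun j => (v 0 j)%:P + w 0 j *: 'X) F.

(* The curve F = 0 has multiplicity m at p: every line through p meets it at *)
(* p with intersection multiplicity at least m, and some line with exactly m.*)
Definition curve_multiplicity F p (m : nat) : Prop :=
  (forall w, 'X^m %| restrict_line F (coords p) w) /\
  (exists w, ~~ ('X^(m.+1) %| restrict_line F (coords p) w)).

(* l is tangent at p to the curve F = 0, i.e. a component of the tangent     *)
(* cone: it meets the curve at p with intersection multiplicity larger than  *)
(* the multiplicity of the curve at p.                                       *)
Definition tangent_line F p l : Prop :=
  incident p l /\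
  exists2 m, curve_multiplicity F p m &
    forall q, incident q l ->
      'X^(m.+1) %| restrict_line F (coords p) (coords q).

End PlaneCurves.

Section Sextic.
Variable R : realType.

Definition F54 : {mpoly R[i][3]} :=
  let X := 'X_0 in let Y := 'X_1 in let Z := 'X_(2 : 'I_3) in
  (X * Y - X * Z + Y * Z) ^+ 3 + 54 * X ^+ 2 * Y ^+ 2 * Z ^+ 2.

Definition C54 : {pred P2 R} := zero_locus F54.

Definition is_cusp54 (p : P2 R) : bool := [exists j, p == vertex R j].

(* The Gauss map; only its values on C54 are meaningful. At a cusp, xget     *)
(* picks the unique tangent line.                                            *)
Definition dual54 (p : P2 R) : P2 R :=
  if is_cusp54 p then xget (vertex R 0) [set l | tangent_line F54 p l]%classic
  else point_of (gradient F54 (coords p)).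

Definition A1 : 'M[R[i]]_3 :=
  \matrix_(j, k) (nth [::]
    [:: [:: - 1 / 3;   7 / 3; - 1 / 3];
        [::   7 / 3; - 1 / 3;   1 / 3];
        [:: - 1 / 3;   1 / 3; - 7 / 3]] j)`_k.

Definition tau (p : P2 R) : P2 R := projective_map A1 (dual54 p).

End Sextic.

Arguments F54 : clear implicits.
Arguments C54 : clear implicits.
Arguments A1 : clear implicits.
Arguments tau : clear implicits.

(* Main.v *)
Require Import Defs.
From mathcomp Require Import all_boot all_order all_algebra.
From mathcomp Require Import reals.
From mathcomp Require Import classical_sets complex mpoly ring.

(* Away from the cusps put (X, Y, Z) = (1/u, -1/v, 1/w). The sextic becomes  *)
(* the smooth cubic (u + v + w)^3 = 54 u v w, and since u + v + w never       *)
(* vanishes there one may normalize to u + v + w = 3, 2 u v w = 1. Then the   *)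
(* gradient is proportional to (u(u-1), -v(v-1), w(w-1)), and after applying  *)
(* A1 the map tau reads (u, v, w) |-> (m v, m u, m w) with the Moebius        *)
(* involution m t = (t - 2) / (2 t - 1), so tau o tau = id. The exceptions    *)
(* are the points where some coordinate is 1/2; these are the three           *)
(* permutations of (1/2, 1/2, 2), which tau exchanges with the three cusps.   *)

Set Implicit Arguments.
Unset Strict Implicit.
Unset Printing Implicit Defensive.

Import GRing.Theory Num.Theory.
Local Open Scope ring_scope.
Local Open Scope quotient_scope.

(** A signed Cremona transformation turns the sextic into the cubic above ([cubic_sextic],
    [sextic_param]), where the Gauss map becomes quadratic ([grad_param]). Up to signs and scale,
    [A1] is the all-ones matrix plus six times the swap of the first two coordinates. Each image
    coordinate is therefore a symmetric function plus six times [t * (t - 1)], which collapses on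
    the cubic to [(2 * t - 1) ^+ 3 / t] ([cube_cubic]). By [cubic_factor] these values are the
    inverses of [mobius t] up to a common factor, so the image lies in the same parametrization
    ([tau_row_mobius]).

    If one coordinate is 1/2, [cubic_factor] forces a second one to be 1/2; two image coordinates
    then vanish and the image is a cusp. Conversely, the tangent cone at a cusp is a triple line, so
    the tangent is unique, and [A1] carries it to the matching exceptional point ([tau_vertex]). By
    [C54_cases] these are all the points. *)

Section Rows.
Variable K : comNzRingType.

(** * Row vectors in coordinates *)

Definition row3 (a b c : K) : 'rV_3 := \row_j [:: a; b; c]`_j.

Lemma row3P (v : 'rV[K]_3) : v = row3 (v 0 0) (v 0 1) (v 0 2).
Proof.
apply/rowP=> j; rewrite mxE; case: j => [[|[|[|//]]] ?] /=;
  by congr (v _ _); apply: val_inj.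
Qed.

Lemma row3E a b c :
  ((row3 a b c 0 0 = a) * (row3 a b c 0 1 = b) * (row3 a b c 0 2 = c))%type.
Proof. by rewrite !mxE. Qed.

Lemma eq_row3 a b c a' b' c' : a = a' -> b = b' -> c = c' ->
  row3 a b c = row3 a' b' c'.
Proof. by move=> -> -> ->. Qed.

Lemma scale_row3 k a b c : k *: row3 a b c = row3 (k * a) (k * b) (k * c).
Proof. by rewrite [LHS]row3P !mxE. Qed.

Lemma row3_eq0 a b c :
  (row3 a b c == 0) = [&& a == 0, b == 0 & c == 0].
Proof.
apply/eqP/and3P => [/rowP e|[/eqP-> /eqP-> /eqP->]].
  by have := (e 0, e 1, e 2); rewrite !mxE /= => -[[-> ->] ->]; rewrite eqxx.
by rewrite [LHS]row3P [RHS]row3P !mxE.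
Qed.

Lemma delta_row3 (j : 'I_3) :
  delta_mx 0 j = row3 (j == 0)%:R (j == 1)%:R (j == 2)%:R.
Proof. by rewrite [LHS]row3P !mxE /= ![_ == j]eq_sym. Qed.

Lemma row3_mulmx a b c (A : 'M[K]_3) :
  row3 a b c *m A = a *: row 0 A + b *: row 1 A + c *: row 2 A.
Proof.
apply/rowP=> j; rewrite !mxE !big_ord_recl big_ord0 addr0 !mxE /= addrA.
by congr (_ * A _ _ + _ * A _ _ + _ * A _ _); apply: val_inj.
Qed.

(** Certificate of ideal membership: once the cofactor [q] of the relation [a = b] is given, [ring]
    can check the rest. *)
Lemma eq_of_multiple (q a b x y : K) : a = b -> x - y = q * (a - b) -> x = y.
Proof. by move=> ->; rewrite subrr mulr0 => /subr0_eq. Qed.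

End Rows.

(** * The sextic form and its partial derivatives *)

Section Sextic.

(** Over any ring, so that [F54], its values and its restrictions to lines are instances of one
    formula, related by ring morphisms. *)
Definition sextic (A : comNzRingType) (x y z : A) :=
  (x * y - x * z + y * z) ^+ 3 + 54 * x ^+ 2 * y ^+ 2 * z ^+ 2.

Definition sextic_x (A : comNzRingType) (x y z : A) :=
  3 * (x * y - x * z + y * z) ^+ 2 * (y - z) + 108 * x * y ^+ 2 * z ^+ 2.

Definition sextic_y (A : comNzRingType) (x y z : A) :=
  3 * (x * y - x * z + y * z) ^+ 2 * (x + z) + 108 * x ^+ 2 * y * z ^+ 2.

Definition sextic_z (A : comNzRingType) (x y z : A) :=
  3 * (x * y - x * z + y * z) ^+ 2 * (y - x) + 108 * x ^+ 2 * y ^+ 2 * z.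

Variables (A B : comNzRingType) (f : {rmorphism A -> B}).

Lemma rmorph_sextic x y z : f (sextic x y z) = sextic (f x) (f y) (f z).
Proof.
by rewrite /sextic !(rmorph_nat, rmorphD, rmorphN, rmorphM, rmorphXn).
Qed.

Lemma derivation_sextic (d : A -> A) x y z :
    {morph d : a b / a + b} ->
    (forall a b, d (a * b) = d a * b + a * d b) ->
  d (sextic x y z) =
  sextic_x x y z * d x + sextic_y x y z * d y + sextic_z x y z * d z.
Proof.
move=> dD dM.
have d0 : d 0 = 0 by apply: (addrI (d 0)); rewrite -dD !addr0.
have d1 : d 1 = 0 by apply: (addrI (d 1)); rewrite -{3}[1]mulr1 dM mulr1 mul1r addr0.
have dn n : d n%:R = 0 by elim: n => // n IH; rewrite -natr1 dD IH d1 addr0.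
have dN a : d (- a) = - d a by apply: (addrI (d a)); rewrite -dD !subrr d0.
rewrite /sextic !exprS !expr0 !(dn, d1, dN, dD, dM).
by rewrite /sextic_x /sextic_y /sextic_z; ring.
Qed.

Lemma rmorph_derivation_sextic (d : A -> A) x y z :
    {morph d : a b / a + b} ->
    (forall a b, d (a * b) = d a * b + a * d b) ->
  f (d (sextic x y z)) =
  sextic_x (f x) (f y) (f z) * f (d x) + sextic_y (f x) (f y) (f z) * f (d y) +
  sextic_z (f x) (f y) (f z) * f (d z).
Proof.
move=> dD dM; rewrite derivation_sextic // /sextic_x /sextic_y /sextic_z.
by rewrite !(rmorph_nat, rmorphD, rmorphN, rmorphM, rmorphXn).
Qed.

End Sextic.

(** * Points of the plane and their representatives *)

Section Points.
Variable R : realType.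
Local Notation C := (R[i]).
Implicit Types (p l : P2 R) (v w : 'rV[C]_3).

Lemma pi_eqP (u v : nzvec R) :
  reflect (\pi_(P2 R) u = \pi_(P2 R) v) (proportional u v).
Proof. exact: (@eqquotP _ _ {eq_quot (proportional_equiv R)}). Qed.

Lemma coords_neq0 p : coords p != 0.
Proof. exact: (valP (repr p)). Qed.

Lemma coordsK p : point_of (coords p) = p.
Proof. by rewrite /point_of /coords valK reprK. Qed.

(** The representative chosen by the quotient is known only up to a nonzero scalar, the [k] carried
    through the later computations. *)
Lemma coords_point_of v : v != 0 ->
  exists2 k, k != 0 & coords (point_of v) = k *: v.
Proof.
move=> v0; rewrite /point_of insubT /coords.
pose u : nzvec R := Sub v v0; have : proportional (repr (\pi_(P2 R) u)) u.
  by apply/(pi_eqP (repr (\pi_(P2 R) u)) u); rewrite reprK.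
move=> /andP[/sub_rVP[k ke] _]; exists k => //.
apply: contraTneq (valP (repr (\pi_(P2 R) u))) => k0.
by rewrite ke k0 scale0r eqxx.
Qed.

Lemma point_ofZ k v : k != 0 -> point_of (k *: v) = point_of v :> P2 R.
Proof.
move=> k0; have [->|v0] := eqVneq v 0; first by rewrite scaler0.
have kv0 : k *: v != 0 by rewrite scaler_eq0 negb_or k0.
rewrite /point_of !insubT; apply/pi_eqP; apply/eqmxP => /=.
exact: eqmx_scale.
Qed.

Lemma vertexE j : vertex R j = point_of (delta_mx 0 j).
Proof. by rewrite /point_of insubT ?delta_neq0 // => ?; apply/pi_eqP/eqmxP. Qed.

Lemma sexticE : F54 R = sextic 'X_0 'X_1 'X_2.
Proof. by []. Qed.

Lemma evalv_F54 x y z : evalv (F54 R) (row3 x y z) = sextic x y z.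
Proof. by rewrite /evalv sexticE rmorph_sextic /= !mevalXU !row3E. Qed.

Lemma gradient_F54 x y z :
  gradient (F54 R) (row3 x y z) =
  row3 (sextic_x x y z) (sextic_y x y z) (sextic_z x y z).
Proof.
pose f : {rmorphism {mpoly C[3]} -> C} := meval (row3 x y z 0).
have fX i : f 'X_i = row3 x y z 0 i by exact: mevalXU.
have dX i j : f ('X_i)^`M(j) = (i == j)%:R.
  rewrite mderivX mnm1E; have [->|_] := eqVneq i j; last first.
    by rewrite scale0r rmorph0.
  by rewrite scale1r -{1}[U_(j)%MM]add0m addmK mpolyX0 rmorph1.
have g j : gradient (F54 R) (row3 x y z) 0 j =
    sextic_x x y z * (0 == j)%:R + sextic_y x y z * (1 == j)%:R +
    sextic_z x y z * (2 == j)%:R.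
  rewrite mxE.
  rewrite [LHS](rmorph_derivation_sextic f _ _ _ (mderivD j) (mderivM j)).
  by rewrite !dX !fX !row3E.
by rewrite [LHS]row3P !g /= !(mulr0, mulr1, addr0, add0r).
Qed.

Lemma restrict_line_F54 v w : let a i := (v 0 i)%:P + w 0 i *: 'X in
  restrict_line (F54 R) v w = sextic (a 0) (a 1) (a 2).
Proof.
by rewrite /restrict_line sexticE rmorph_sextic /= !mmapX !mmap1U.
Qed.

End Points.

(** * The cubic model and its Moebius involution *)

Section Cubic.
Variable K : numFieldType.
Implicit Types u v w : K.

Definition cubic u v w := u + v + w = 3 /\ 2 * u * v * w = 1.

Lemma cubicC u v w : cubic u v w -> cubic v u w.
Proof. by rewrite /cubic (mulrAC 2) [v + u]addrC. Qed.

Lemma cubic_rot u v w : cubic u v w -> cubic v w u.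
Proof. by case=> s e; split; [rewrite -[RHS]s | rewrite -[RHS]e]; ring. Qed.

Lemma cubic_neq0 u v w : cubic u v w -> [/\ u != 0, v != 0 & w != 0].
Proof.
case=> _ e; have := oner_neq0 K.
by rewrite -e !mulf_eq0 !negb_or => /andP[/andP[/andP[_ -> ->] ->]].
Qed.

(* (1/u, -1/v, 1/w), cleared of denominators using 2 u v w = 1. *)
Definition param u v w := row3 (2 * v * w) (- (2 * u * w)) (2 * u * v).

Lemma param_neq0 u v w : cubic u v w -> param u v w != 0.
Proof.
case/cubic_neq0 => u0 v0 w0; rewrite row3_eq0 !mulf_eq0 pnatr_eq0 /=.
by rewrite (negPf v0) (negPf w0).
Qed.

Lemma sextic_param k u v w : cubic u v w ->
  sextic (k * (2 * v * w)) (k * - (2 * u * w)) (k * (2 * u * v)) = 0.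
Proof.
case=> s e.
have -> : sextic (k * (2 * v * w)) (k * - (2 * u * w)) (k * (2 * u * v)) =
    k ^+ 6 * (2 * u * v * w) ^+ 3 * 4 *
    (54 * (2 * u * v * w) - 2 * (u + v + w) ^+ 3).
  by rewrite /sextic; ring.
by rewrite e s; ring.
Qed.

Lemma cubic_sextic x y z : sextic x y z = 0 -> x != 0 -> y != 0 -> z != 0 ->
  exists u v w k, [/\ cubic u v w, k != 0 & row3 x y z = k *: param u v w].
Proof.
move=> e x0 y0 z0.
set s := x * y - x * z + y * z.
have es : s ^+ 3 = - (54 * x ^+ 2 * y ^+ 2 * z ^+ 2).
  by apply/eqP; rewrite -addr_eq0 -e.
have n (m : nat) : m.+1%:R != 0 :> K by rewrite pnatr_eq0.
have s0 : s != 0.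
  have : s ^+ 3 != 0 by rewrite es oppr_eq0 !mulf_neq0 ?expf_neq0.
  by rewrite expf_eq0.
(* The inverses of [x], [- y], [z] are proportional to [y z], [- x z], [x y], whose sum is [s]; the
   factor [3 / s] makes the sum 3. The scalar that follows is [x / (2 * v * w)] for these values. *)
exists (3 * y * z / s), (- (3 * x * z / s)), (3 * x * y / s).
exists (- (s ^+ 2 / (18 * x * y * z))); split.
- split; first by rewrite /s; field.
  have -> : 2 * (3 * y * z / s) * - (3 * x * z / s) * (3 * x * y / s) =
    - (54 * x ^+ 2 * y ^+ 2 * z ^+ 2) / s ^+ 3 by field.
  by rewrite -es divff ?expf_neq0.
- by rewrite oppr_eq0 !mulf_neq0 ?invr_neq0 ?mulf_neq0 ?expf_neq0.
- by rewrite scale_row3; apply: eq_row3; field; rewrite s0 x0 y0 z0 /=.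
Qed.

(** On the curve [x * y - x * z + y * z] is [- 6 k ^+ 2], so the first partial derivative is
    [216 k ^+ 5 u] times [2 - (v + w)], with [v + w = 3 - u]; the others are alike up to sign. *)
Lemma grad_param k u v w x y z : cubic u v w ->
    x = k * (2 * v * w) -> y = k * - (2 * u * w) -> z = k * (2 * u * v) ->
  row3 (sextic_x x y z) (sextic_y x y z) (sextic_z x y z) =
  (216 * k ^+ 5) *: row3 (u * (u - 1)) (- (v * (v - 1))) (w * (w - 1)).
Proof.
case=> s e ex ey ez; have ew : w = 3 - u - v by rewrite -s; ring.
have eS : x * y - x * z + y * z = - (6 * k ^+ 2).
  transitivity (- (2 * k ^+ 2 * (2 * u * v * w) * (u + v + w))).
    by rewrite ex ey ez; ring.
  by rewrite s e; ring.
rewrite scale_row3; apply: eq_row3.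
- rewrite /sextic_x eS ex ey ez.
  transitivity (216 * k ^+ 5 * u * (2 * (2 * u * v * w) ^+ 3 - (v + w))).
    by ring.
  by rewrite e ew; ring.
- rewrite /sextic_y eS ex ey ez.
  transitivity (- 216 * k ^+ 5 * v * (2 * (2 * u * v * w) ^+ 3 - (u + w))).
    by ring.
  by rewrite e ew; ring.
- rewrite /sextic_z eS ex ey ez.
  transitivity (216 * k ^+ 5 * w * (2 * (2 * u * v * w) ^+ 3 - (u + v))).
    by ring.
  by rewrite e ew; ring.
Qed.

(** Multiplied by [u], the left side becomes a cubic in [u] alone once [v] and [w] are eliminated,
    and this cubic is a perfect cube. *)
Lemma cube_cubic u v w : cubic u v w ->
  u * (u - 1) + v * (v - 1) + w * (w - 1) + 6 * (u * (u - 1)) =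
  (2 * u - 1) ^+ 3 / u.
Proof.
move=> c; have [u0 _ _] := cubic_neq0 c; case: c => s e.
apply: (mulfI u0); rewrite [RHS]mulrCA divff // mulr1.
have ew : w = 3 - u - v by rewrite -s; ring.
by apply: (eq_of_multiple (q := -1) e); rewrite ew; ring.
Qed.

(* Up to a scalar, the coordinates of the image under tau of param u v w. *)
Definition tau_row u v w :=
  row3 ((2 * v - 1) ^+ 3 / v) (- ((2 * u - 1) ^+ 3 / u)) ((2 * w - 1) ^+ 3 / w).

Definition mobius t : K := (t - 2) / (2 * t - 1).

(** Hence the image avoids the pole 1/2, and the generic formula for [tau] applies a second time. *)
Lemma mobius_den t : 2 * t - 1 != 0 -> 2 * mobius t - 1 = - 3 / (2 * t - 1).
Proof. by move=> t0; rewrite /mobius; field. Qed.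

Lemma mobiusK t : 2 * t - 1 != 0 -> mobius (mobius t) = t.
Proof.
move=> t0; rewrite /mobius; field; rewrite t0.
have -> : 2 * (t - 2) + (-1) * (2 * t - 1) = - 3 by ring.
by rewrite oppr_eq0 pnatr_eq0.
Qed.

Lemma cubic_mobius u v w : cubic u v w ->
    2 * u - 1 != 0 -> 2 * v - 1 != 0 -> 2 * w - 1 != 0 ->
  cubic (mobius u) (mobius v) (mobius w).
Proof.
case=> s e u1 v1 w1; have ew : w = 3 - u - v by rewrite -s; ring.
have D0 : (2 * u - 1) * (2 * v - 1) * (2 * w - 1) != 0.
  by rewrite !mulf_neq0.
split; rewrite /mobius; apply: (mulfI D0).
- transitivity ((u - 2) * (2 * v - 1) * (2 * w - 1) +
    (v - 2) * (2 * u - 1) * (2 * w - 1) + (w - 2) * (2 * u - 1) * (2 * v - 1)).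
    by field; rewrite u1 v1 w1.
  by apply: (eq_of_multiple (q := - 6) e); rewrite ew; ring.
- transitivity (2 * (u - 2) * (v - 2) * (w - 2)).
    by field; rewrite u1 v1 w1.
  by apply: (eq_of_multiple (q := - 3) e); rewrite ew; ring.
Qed.

(** By [v + w = 3 - u] and [2 u v w = 1], the left side expands to [2 u ^+ 2 - 5 u + 2]. *)
Lemma cubic_factor u v w : cubic u v w ->
  u * ((2 * v - 1) * (2 * w - 1)) = (u - 2) * (2 * u - 1).
Proof.
case=> s e; have ew : w = 3 - u - v by rewrite -s; ring.
by apply: (eq_of_multiple (q := 2) e); rewrite ew; ring.
Qed.

(** By [cubic_factor] the left side is the product of the three factors divided by [mobius u], whose
    inverse is [2 * mobius v * mobius w] because the images again satisfy [cubic]. *)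
Lemma cube_mobius u v w : cubic u v w ->
    2 * u - 1 != 0 -> 2 * v - 1 != 0 -> 2 * w - 1 != 0 ->
  (2 * u - 1) ^+ 3 / u = (2 * u - 1) * (2 * v - 1) * (2 * w - 1) *
    (2 * mobius v * mobius w).
Proof.
move=> c u1 v1 w1; have [u0 _ _] := cubic_neq0 c.
have c' := cubic_mobius c u1 v1 w1; have [mu0 _ _] := cubic_neq0 c'.
have e := cubic_factor c.
apply: (mulfI u0); apply: (mulfI mu0).
transitivity ((u - 2) * (2 * u - 1) * (2 * u - 1)).
  by rewrite /mobius; field; rewrite u0 u1.
by rewrite -e; apply: (eq_of_multiple (q := - (u * ((2 * v - 1) * (2 * w - 1)) *
  (2 * u - 1))) c'.2); ring.
Qed.

Lemma tau_row_mobius u v w : cubic u v w ->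
    2 * u - 1 != 0 -> 2 * v - 1 != 0 -> 2 * w - 1 != 0 ->
  tau_row u v w = ((2 * u - 1) * (2 * v - 1) * (2 * w - 1)) *:
    param (mobius v) (mobius u) (mobius w).
Proof.
move=> c u1 v1 w1; rewrite scale_row3 /tau_row.
have cv := cubic_rot c; have cw := cubic_rot cv.
rewrite (cube_mobius c) // (cube_mobius cv) // (cube_mobius cw) //.
by apply: eq_row3; ring.
Qed.

(** The right side of [cubic_factor] vanishes, so a second coordinate is 1/2; the sum gives the
    third. *)
Lemma cubic_half u v w : cubic u v w -> 2 * u - 1 = 0 ->
  [\/ [/\ u = 1 / 2, v = 1 / 2 & w = 2] | [/\ u = 1 / 2, v = 2 & w = 1 / 2]].
Proof.
have half (t : K) : 2 * t - 1 = 0 -> t = 1 / 2.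
  by move=> h; apply: (eq_of_multiple (q := 1 / 2) h); field.
move=> c u1; have [u0 _ _] := cubic_neq0 c; have := cubic_factor c.
rewrite u1 mulr0 => /eqP; rewrite !mulf_eq0 (negPf u0) /= (half u u1).
have s := c.1; rewrite (half u u1) in s.
case/orP => /eqP /half h; [left | right]; split=> //.
  by apply: (eq_of_multiple (q := 1) s); rewrite h; field.
by apply: (eq_of_multiple (q := 1) s); rewrite h; field.
Qed.

Variant cubic_spec u v w : Prop :=
| CubicGeneric of 2 * u - 1 != 0 & 2 * v - 1 != 0 & 2 * w - 1 != 0
| CubicU of u = 2 & v = 1 / 2 & w = 1 / 2
| CubicV of u = 1 / 2 & v = 2 & w = 1 / 2
| CubicW of u = 1 / 2 & v = 1 / 2 & w = 2.

Lemma cubicP u v w : cubic u v w -> cubic_spec u v w.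
Proof.
move=> c; have [u1|u1] := eqVneq (2 * u - 1) 0.
  by case: (cubic_half c u1) => -[? ? ?]; [apply: CubicW | apply: CubicV].
have [v1|v1] := eqVneq (2 * v - 1) 0.
  by case: (cubic_half (cubic_rot c) v1) => -[? ? ?];
    [apply: CubicU | apply: CubicW].
have [w1|w1] := eqVneq (2 * w - 1) 0; last exact: CubicGeneric.
by case: (cubic_half (cubic_rot (cubic_rot c)) w1) => -[? ? ?];
  [apply: CubicV | apply: CubicU].
Qed.

End Cubic.

(** * Tangent lines at the cusps *)

Lemma horner0_cube (A : comNzRingType) (m : A) (a b : {poly A}) :
  ((m%:P + 'X * a) ^+ 3 + 'X * b).[0] = m ^+ 3.
Proof. by rewrite !hornerE; ring. Qed.

Section Tangents.
Variable R : realType.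
Local Notation C := (R[i]).
Implicit Types (p l : P2 R) (v w : 'rV[C]_3).

(* Coordinates of the tangent line at the j-th cusp: Y = Z, X = -Z, X = Y. *)
Definition cusp_line (j : 'I_3) : 'rV[C]_3 :=
  [:: row3 0 1 (-1); row3 1 0 1; row3 (-1) 1 0]`_j.

Lemma cusp_line_neq0 j : cusp_line j != 0.
Proof.
case: j => [[|[|[|//]]] ?];
  by rewrite row3_eq0 ?oppr_eq0 oner_eq0 ?andbF.
Qed.

Lemma row3_pairing (a b c a' b' c' : C) :
  (row3 a b c *m (row3 a' b' c')^T) 0 0 = a * a' + b * b' + c * c'.
Proof. by rewrite !mxE !big_ord_recl big_ord0 addr0 !mxE /= addrA. Qed.

Lemma mx11_eq0 (A : 'M[C]_1) : (A == 0) = (A 0 0 == 0).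
Proof.
apply/eqP/eqP => [->|e]; first by rewrite mxE.
by apply/matrixP => i j; rewrite !ord1 e mxE.
Qed.

(* The coefficient of 'X^3 is a cube: the tangent cone is a triple line. *)
Lemma restrict_line_vertex j k w :
  exists a b, restrict_line (F54 R) (k *: delta_mx 0 j) w =
  'X^3 * (((k * (w *m (cusp_line j)^T) 0 0)%:P + 'X * a) ^+ 3 + 'X * b).
Proof.
rewrite restrict_line_F54 delta_row3 scale_row3 !row3E [w]row3P !row3E.
move: (w 0 0) (w 0 1) (w 0 2) => x y z.
exists (x%:P * y%:P - x%:P * z%:P + y%:P * z%:P).
case: j => [[|[|[|//]]] ?] /=;
  rewrite row3_pairing !(mulr1, mulr0, polyC0, add0r) -!mul_polyC.
- exists (54 * (k%:P + x%:P * 'X) ^+ 2 * y%:P ^+ 2 * z%:P ^+ 2).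
  by rewrite /sextic; ring.
- exists (54 * (k%:P + y%:P * 'X) ^+ 2 * x%:P ^+ 2 * z%:P ^+ 2).
  by rewrite /sextic; ring.
- exists (54 * (k%:P + z%:P * 'X) ^+ 2 * x%:P ^+ 2 * y%:P ^+ 2).
  by rewrite /sextic; ring.
Qed.

Lemma coords_vertex j :
  exists2 k, k != 0 & coords (vertex R j) = k *: delta_mx 0 j.
Proof. by rewrite vertexE; apply/coords_point_of/delta_neq0. Qed.

Lemma dvd3_vertex j w : 'X^3 %| restrict_line (F54 R) (coords (vertex R j)) w.
Proof.
have [k k0 ->] := coords_vertex j.
by have [a [b ->]] := restrict_line_vertex j k w; apply: dvdp_mulIl.
Qed.

Lemma dvd4_vertex j w :
  ('X^4 %| restrict_line (F54 R) (coords (vertex R j)) w) =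
  (w *m (cusp_line j)^T == 0).
Proof.
have [k k0 ->] := coords_vertex j.
have [a [b ->]] := restrict_line_vertex j k w.
rewrite exprSr dvdp_mul2l ?expf_neq0 ?polyX_eq0 //.
have dX (q : {poly C}) : ('X %| q) = root q 0.
  by rewrite -dvdp_XsubCl polyC0 subr0.
rewrite dX rootE horner0_cube.
by rewrite expf_eq0 /= mulf_eq0 (negPf k0) mx11_eq0.
Qed.

Lemma multiplicity_vertex j m :
  curve_multiplicity (F54 R) (vertex R j) m <-> m = 3%N.
Proof.
(* The vector [cusp_line j] itself is a transverse direction: its pairing with itself is 2. *)
have ncusp : exists w, ~~ ('X^4 %| restrict_line (F54 R) (coords (vertex R j)) w).
  have : cusp_line j *m (cusp_line j)^T != 0.
    rewrite mx11_eq0; case: j => [[|[|[|//]]] ?];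
    by rewrite row3_pairing /= !(mulr1, mulr0, mulrNN, add0r, addr0) (pnatr_eq0 _ 2).
  by exists (cusp_line j); rewrite dvd4_vertex.
split=> [[mle [w nw]]|->]; last by split=> // w; exact: dvd3_vertex.
case: ncusp => w' nw'; apply/eqP; rewrite eqn_leq; apply/andP; split.
- rewrite leqNgt; apply: contra nw' => m3.
  exact: dvdp_trans (dvdp_exp2l _ m3) (mle w').
- rewrite leqNgt; apply: contra nw => m3.
  exact: dvdp_trans (dvdp_exp2l _ m3) (dvd3_vertex j w).
Qed.

Lemma incident_point_of q v : v != 0 ->
  incident q (point_of v) = (coords q *m v^T == 0).
Proof.
move=> v0; have [k k0 kE] := coords_point_of v0.
by rewrite /incident kE linearZ /= -scalemxAr scaler_eq0 (negPf k0).
Qed.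

Lemma line_eq l v : v != 0 ->
  (forall q, incident q l -> coords q *m v^T = 0) -> l = point_of v.
Proof.
move=> v0 h; set u := coords l.
have hx (x : 'rV[C]_3) : x *m u^T = 0 -> x *m v^T = 0.
  have [-> _|x0 xu] := eqVneq x 0; first by rewrite mul0mx.
  have [k k0 kE] := coords_point_of x0.
  have := h (point_of x); rewrite /incident kE -!scalemxAl xu scaler0 eqxx.
  by move=> /(_ isT)/eqP; rewrite scaler_eq0 (negPf k0) => /eqP.
have /rV0Pn[i ui] := coords_neq0 l; rewrite -/u in ui.
(* Test the hypothesis on the vectors u_i e_j - u_j e_i orthogonal to u. *)
have e : v = (v 0 i / u 0 i) *: u.
  apply/rowP=> j; rewrite mxE.
  have := hx (u 0 i *: delta_mx 0 j - u 0 j *: delta_mx 0 i).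
  rewrite !mulmxBl -!scalemxAl -!rowE.
  have row_tr (z : 'rV[C]_3) n : row n z^T = (z 0 n)%:M.
    by apply/matrixP => a b; rewrite !ord1 !mxE eqxx.
  rewrite !row_tr !scale_scalar_mx [u 0 i * _]mulrC subrr => /(_ erefl).
  move/subr0_eq/matrixP/(_ 0 0); rewrite !mxE /= !mulr1n => e.
  by apply: (mulfI ui); rewrite e; field.
have k0 : v 0 i / u 0 i != 0 by apply: contraNneq v0 => k0; rewrite e k0 scale0r.
by rewrite e point_ofZ // coordsK.
Qed.

(** As the multiplicity is 3, tangency puts every point of [l] under the ['X^4] condition, that is,
    on the cusp line. The resulting uniqueness determines the value of [xget] in [dual54]. *)
Lemma tangent_line_vertex j l :
  tangent_line (F54 R) (vertex R j) l <-> l = point_of (cusp_line j).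
Proof.
have c0 := cusp_line_neq0 j; split=> [[_ [m /multiplicity_vertex -> h]]|->].
  by apply: line_eq => // q /h; rewrite dvd4_vertex => /eqP.
split.
  rewrite incident_point_of //; have [k _ ->] := coords_vertex j.
  rewrite -scalemxAl delta_row3 mx11_eq0 mxE.
  case: j {c0} => [[|[|[|//]]] ?];
    by rewrite row3_pairing /= !(mulr0, mul0r, addr0).
exists 3%N; first exact/multiplicity_vertex.
by move=> q; rewrite incident_point_of // dvd4_vertex.
Qed.

Lemma dual54_vertex j : dual54 (vertex R j) = point_of (cusp_line j).
Proof.
rewrite /dual54 ifT; last by apply/existsP; exists j.
by apply: xget_unique => [|l /tangent_line_vertex//]; apply/tangent_line_vertex.
Qed.

Lemma projective_map_point_of (A : 'M[C]_3) v : v != 0 ->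
  projective_map A (point_of v) = point_of (v *m A).
Proof.
move=> v0; have [k k0 kE] := coords_point_of v0.
by rewrite /projective_map kE -scalemxAl point_ofZ.
Qed.

Lemma point_of_eq k v w : k != 0 -> v = k *: w -> point_of v = point_of w :> P2 R.
Proof. by move=> k0 ->; exact: point_ofZ. Qed.

Lemma projective_map_A1 a b c : row3 a b c != 0 ->
  projective_map (A1 R) (point_of (row3 a b c)) =
  point_of (row3 (- a + 7 * b - c) (7 * a - b + c) (- a + b - 7 * c)).
Proof.
move=> v0; rewrite projective_map_point_of //.
have k0 : 3^-1 != 0 :> C by rewrite invr_eq0 pnatr_eq0.
apply: (point_of_eq k0); rewrite row3_mulmx scale_row3 [LHS]row3P !mxE /=.
by apply: eq_row3; field.
Qed.

End Tangents.

(** * The map [tau] on the parametrized points and on the cusps *)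

Section Tau.
Variable R : realType.
Local Notation C := (R[i]).
Implicit Types (u v w : C).

Definition point54 u v w : P2 R := point_of (param u v w).

Lemma coords_point54 u v w : cubic u v w -> exists2 k, k != 0 &
  coords (point54 u v w) =
  row3 (k * (2 * v * w)) (k * - (2 * u * w)) (k * (2 * u * v)).
Proof.
move=> c; have [k k0 kE] := coords_point_of (param_neq0 c).
by exists k; rewrite // /point54 kE scale_row3.
Qed.

Lemma vertex_C54 j : vertex R j \in C54 R.
Proof.
have [k k0 kE] := coords_vertex R j.
rewrite inE kE delta_row3 scale_row3 evalv_F54.
by case: j {kE} => [[|[|[|//]]] ?]; rewrite /sextic /=; apply/eqP; ring.
Qed.

Lemma point54_C54 u v w : cubic u v w -> point54 u v w \in C54 R.
Proof.
move=> c; have [k k0 kE] := coords_point54 c.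
by rewrite inE kE evalv_F54 sextic_param.
Qed.

Lemma point54_noncusp u v w : cubic u v w -> ~~ is_cusp54 (point54 u v w).
Proof.
move=> c; have [k k0 kE] := coords_point54 c.
have [u0 v0 w0] := cubic_neq0 c.
apply/existsP => -[j /eqP e]; move: kE; rewrite e.
have [k' k'0 ->] := coords_vertex R j.
rewrite delta_row3 scale_row3 => /rowP kE.
move: (kE 0) (kE 1) (kE 2); rewrite !row3E.
have n0 : k * (2 * v * w) != 0 by rewrite !mulf_neq0 ?pnatr_eq0.
have n1 : k * - (2 * u * w) != 0 by rewrite mulf_neq0 ?oppr_eq0 ?mulf_neq0 ?pnatr_eq0.
case: j {e kE} => [[|[|[|//]]] ?] /=; rewrite !mulr0 => e0 e1 e2.
- by rewrite -e1 eqxx in n1.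
- by rewrite -e0 eqxx in n0.
- by rewrite -e0 eqxx in n0.
Qed.

Lemma vertex_row3 (k : C) : k != 0 ->
  [/\ point_of (row3 k 0 0) = vertex R 0, point_of (row3 0 k 0) = vertex R 1
    & point_of (row3 0 0 k) = vertex R 2].
Proof.
move=> k0; split; rewrite vertexE; apply: (point_of_eq k0);
  by rewrite delta_row3 scale_row3 /= !(mulr0, mulr1).
Qed.

(** If one coordinate vanishes, the equation says that the cube of the product of the other two is
    zero, so a second coordinate vanishes and the point is a vertex. *)
Lemma C54_cases p : p \in C54 R ->
  (exists j, p = vertex R j) \/
  exists u v w, cubic u v w /\ p = point54 u v w.
Proof.
rewrite inE; move: (coordsK p) (coords_neq0 p).
rewrite [coords p]row3P evalv_F54.
move: (coords p 0 0) (coords p 0 1) (coords p 0 2) => x y z <- nz /eqP e.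
have cub (a : C) b : (a * b) ^+ 3 = 0 -> a = 0 \/ b = 0.
  by move/eqP; rewrite expf_eq0 mulf_eq0 => /orP[] /eqP; [left | right].
move: nz; rewrite row3_eq0; have [x0|x0] := eqVneq x 0.
  have [y0|z0] : y = 0 \/ z = 0 by apply: cub; rewrite -e /sextic x0; ring.
    by rewrite x0 y0 eqxx => /vertex_row3[_ _ ->]; left; exists 2.
  by rewrite x0 z0 eqxx andbT => /vertex_row3[_ -> _]; left; exists 1.
have [y0 _|y0 _] := eqVneq y 0.
  have z0 : z = 0.
    have [|//] : x = 0 \/ z = 0.
      by apply: cub; rewrite -[RHS]oppr0 -e /sextic y0; ring.
    by move/eqP; rewrite (negPf x0).
  by left; exists 0; rewrite y0 z0; case: (vertex_row3 x0).
have [z0|z0] := eqVneq z 0.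
  have [] : x = 0 \/ y = 0 by apply: cub; rewrite -e /sextic z0; ring.
    by move/eqP; rewrite (negPf x0).
  by move/eqP; rewrite (negPf y0).
right; have [u [v [w [k [c k0 ->]]]]] := cubic_sextic e x0 y0 z0.
by exists u, v, w; rewrite point_ofZ.
Qed.

Lemma tau_vertex0 u v w : u = 1 / 2 -> v = 2 -> w = 1 / 2 ->
  tau R (vertex R 0) = point54 u v w.
Proof.
have l0 : row3 0 1 (-1) != 0 :> 'rV[C]_3 := cusp_line_neq0 R 0.
have lE : cusp_line R 0 = row3 0 1 (-1) by [].
rewrite /tau dual54_vertex lE (projective_map_A1 l0) => -> -> ->.
(* Up to the factor 1/3, [A1] sends [(0, 1, -1)] to [(8, -2, 8)], which is 4 times [param] at
   [(1/2, 2, 1/2)]. *)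
have k0 : 4 != 0 :> C by rewrite pnatr_eq0.
by apply: (point_of_eq k0); rewrite scale_row3; apply: eq_row3; field.
Qed.

Lemma tau_vertex1 u v w : u = 2 -> v = 1 / 2 -> w = 1 / 2 ->
  tau R (vertex R 1) = point54 u v w.
Proof.
have l0 : row3 1 0 1 != 0 :> 'rV[C]_3 := cusp_line_neq0 R 1.
have lE : cusp_line R 1 = row3 1 0 1 by [].
rewrite /tau dual54_vertex lE (projective_map_A1 l0) => -> -> ->.
have k0 : - 4 != 0 :> C by rewrite oppr_eq0 pnatr_eq0.
by apply: (point_of_eq k0); rewrite scale_row3; apply: eq_row3; field.
Qed.

Lemma tau_vertex2 u v w : u = 1 / 2 -> v = 1 / 2 -> w = 2 ->
  tau R (vertex R 2) = point54 u v w.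
Proof.
have l0 : row3 (-1) 1 0 != 0 :> 'rV[C]_3 := cusp_line_neq0 R 2.
have lE : cusp_line R 2 = row3 (-1) 1 0 by [].
rewrite /tau dual54_vertex lE (projective_map_A1 l0) => -> -> ->.
have k0 : 4 != 0 :> C by rewrite pnatr_eq0.
by apply: (point_of_eq k0); rewrite scale_row3; apply: eq_row3; field.
Qed.

(** All coordinates being nonzero, the gradient could vanish only at [u = v = w = 1], which violates
    [2 u v w = 1]; so the curve is smooth off the cusps. *)
Lemma gauss_neq0 u v w : cubic u v w ->
  row3 (u * (u - 1)) (- (v * (v - 1))) (w * (w - 1)) != 0.
Proof.
move=> c; have [u0 v0 w0] := cubic_neq0 c.
rewrite row3_eq0 oppr_eq0 !mulf_eq0 (negPf u0) (negPf v0) (negPf w0) /= !subr_eq0.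
apply/negP => /and3P[/eqP u1 /eqP v1 /eqP w1]; have := c.2.
rewrite u1 v1 w1 !mulr1 => /eqP; rewrite -subr_eq0.
by have -> : 2 - 1 = 1 :> C by [ring]; rewrite oner_eq0.
Qed.

Lemma tau_point54 u v w : cubic u v w ->
  tau R (point54 u v w) = point_of (tau_row u v w).
Proof.
move=> c; rewrite /tau /dual54 (negPf (point54_noncusp c)).
have [k k0 ->] := coords_point54 c.
have k5 : 216 * k ^+ 5 != 0 by rewrite mulf_neq0 ?expf_neq0 ?pnatr_eq0.
rewrite gradient_F54 (grad_param c erefl erefl erefl) (point_ofZ _ k5).
rewrite (projective_map_A1 (gauss_neq0 c)).
(* After the signs are absorbed, [A1] is a negative multiple of the all-ones matrix plus six times
   the swap, hence the scalar -1. *)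
have n0 : - 1 != 0 :> C by rewrite oppr_eq0 oner_eq0.
apply: (point_of_eq n0); rewrite scale_row3.
rewrite -(cube_cubic c) -(cube_cubic (cubicC c)).
rewrite -(cube_cubic (cubic_rot (cubic_rot c))).
by apply: eq_row3; ring.
Qed.

Lemma cube_half (t : C) : t = 1 / 2 -> (2 * t - 1) ^+ 3 / t = 0.
Proof. by move=> ->; field. Qed.

Lemma cube_two_neq0 (t : C) : t = 2 -> (2 * t - 1) ^+ 3 / t != 0.
Proof.
move=> t2; have -> : (2 * t - 1) ^+ 3 / t = 27 / t by rewrite t2; field.
by rewrite t2 mulf_eq0 invr_eq0 !pnatr_eq0.
Qed.

(** The two coordinates equal to 1/2 kill their entries of [tau_row]; the surviving entry comes from
    [v], which the swap puts in first place. *)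
Lemma tau_hyperflex0 u v w :
    cubic u v w -> u = 1 / 2 -> v = 2 -> w = 1 / 2 ->
  tau R (point54 u v w) = vertex R 0 /\ tau R (vertex R 0) = point54 u v w.
Proof.
move=> c eu ev ew; split; last exact: tau_vertex0.
rewrite (tau_point54 c) /tau_row (cube_half eu) (cube_half ew) oppr0.
by case: (vertex_row3 (cube_two_neq0 ev)).
Qed.

Lemma tau_hyperflex1 u v w :
    cubic u v w -> u = 2 -> v = 1 / 2 -> w = 1 / 2 ->
  tau R (point54 u v w) = vertex R 1 /\ tau R (vertex R 1) = point54 u v w.
Proof.
move=> c eu ev ew; split; last exact: tau_vertex1.
rewrite (tau_point54 c) /tau_row (cube_half ev) (cube_half ew).
have nz : - ((2 * u - 1) ^+ 3 / u) != 0 by rewrite oppr_eq0 cube_two_neq0.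
by case: (vertex_row3 nz).
Qed.

Lemma tau_hyperflex2 u v w :
    cubic u v w -> u = 1 / 2 -> v = 1 / 2 -> w = 2 ->
  tau R (point54 u v w) = vertex R 2 /\ tau R (vertex R 2) = point54 u v w.
Proof.
move=> c eu ev ew; split; last exact: tau_vertex2.
rewrite (tau_point54 c) /tau_row (cube_half eu) (cube_half ev) oppr0.
by case: (vertex_row3 (cube_two_neq0 ew)).
Qed.

Lemma tau_vertex (j : 'I_3) : exists u v w, [/\ cubic u v w,
  tau R (vertex R j) = point54 u v w & tau R (point54 u v w) = vertex R j].
Proof.
have h0 : cubic (1 / 2 : C) 2 (1 / 2) by split; field.
have h1 : cubic (2 : C) (1 / 2) (1 / 2) by split; field.
have h2 : cubic (1 / 2 : C) (1 / 2) 2 by split; field.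
have [e0 f0] := tau_hyperflex0 h0 erefl erefl erefl.
have [e1 f1] := tau_hyperflex1 h1 erefl erefl erefl.
have [e2 f2] := tau_hyperflex2 h2 erefl erefl erefl.
case: j => [[|[|[|//]]] lt_j3].
- have -> : Ordinal lt_j3 = 0 by apply: val_inj.
  by exists (1 / 2), 2, (1 / 2); apply: And3 h0 f0 e0.
- have -> : Ordinal lt_j3 = 1 by apply: val_inj.
  by exists 2, (1 / 2), (1 / 2); apply: And3 h1 f1 e1.
- have -> : Ordinal lt_j3 = 2 by apply: val_inj.
  by exists (1 / 2), (1 / 2), 2; apply: And3 h2 f2 e2.
Qed.

Lemma tau_generic u v w : cubic u v w ->
    2 * u - 1 != 0 -> 2 * v - 1 != 0 -> 2 * w - 1 != 0 ->
  tau R (point54 u v w) = point54 (mobius v) (mobius u) (mobius w).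
Proof.
move=> c u1 v1 w1.
by rewrite (tau_point54 c) (tau_row_mobius c) // point_ofZ ?mulf_neq0.
Qed.

End Tau.

Theorem proposition2p12 (R : realType) :
  {homo tau R : p / p \in C54 R} /\ {in C54 R, involutive (tau R)}.
Proof.
suff h p : p \in C54 R -> tau R p \in C54 R /\ tau R (tau R p) = p.
  by split=> p /h[].
case/C54_cases => [[j ->]|[u [v [w [c ->]]]]].
  have [u [v [w [c e1 e2]]]] := tau_vertex R j.
  by rewrite e1 e2 point54_C54.
case: (cubicP c) => [u1 v1 w1|hu hv hw|hu hv hw|hu hv hw].
(* [cubicC] accounts for the exchange of the first two coordinates; the second application of [tau]
   exchanges them back. *)
- have c' := cubicC (cubic_mobius c u1 v1 w1).
  have n t : 2 * t - 1 != 0 :> R[i] -> 2 * mobius t - 1 != 0.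
    move=> t1; rewrite mobius_den // mulf_eq0 invr_eq0 oppr_eq0 negb_or t1.
    by rewrite pnatr_eq0.
  rewrite (tau_generic c u1 v1 w1) point54_C54 //; split=> //.
  by rewrite (tau_generic c') ?n // !mobiusK.
- have [e1 e2] := tau_hyperflex1 c hu hv hw; by rewrite e1 e2 vertex_C54.
- have [e1 e2] := tau_hyperflex0 c hu hv hw; by rewrite e1 e2 vertex_C54.
- have [e1 e2] := tau_hyperflex2 c hu hv hw; by rewrite e1 e2 vertex_C54.
Qed.
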